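(* Let $f_{0,0}(x)=f_{1,0}(x)=\frac{x}{2}$ and $f_{0,1}(x)=f_{1,1}(x)=\frac{x+1}{2}$ for $x\in[0,1]$. For $i,j\in\{0,1\}$ let $A_{i,j}=\begin{pmatrix}a_{i,j}&b_{i,j}\\ c_{i,j}&d_{i,j}\end{pmatrix}\in\mathscr{M}$ and $g_{i,j}(x)=\Phi(A_{i,j};x)$, $x\in[0,1]$, and assume that each of $\{g_{0,0},g_{0,1}\}$ and $\{g_{1,0},g_{1,1}\}$ is an LF system. Let $$\alpha_i=\frac{c_{i,0}+d_{i,0}}{a_{i,0}}-2=\frac{d_{i,1}}{b_{i,1}}-2,\qquad i=0,1.$$ Let $(\varphi_0,\varphi_1)$ be the pair of increasing continuous maps $\varphi_0,\varphi_1:[0,1]\to[0,1]$ solving $$g_{i,j}(\varphi_j(x))=\varphi_i(f_{i,j}(x)),\qquad x\in[0,1],\ i,j\in\{0,1\}.$$ (i) If $\Phi(A_{i,j}^{\top};\alpha_i)\neq\alpha_j$ holds for some $i,j\in\{0,1\}$, then both $\varphi_0$ and $\varphi_1$ are singular. (ii) If $\Phi(A_{i,j}^{\top};\alpha_i)=\alpha_j$ holds for every $i,j\in\{0,1\}$, then $$\varphi_0(x)=\frac{x}{-c_{0,0}x+1+c_{0,0}}\quad\text{and}\quad \varphi_1(x)=\frac{x}{-c_{1,1}x+1+c_{1,1}}.$$ In particular, both $\varphi_0$ and $\varphi_1$ are smooth.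
   Context: A real $2\times2$ matrix $A=\begin{pmatrix}a&b\\c&d\end{pmatrix}$ belongs to the class $\mathscr{M}$ if $0<a+b\le c+d$, $d>b\ge0$, $ad-bc>0$ and $\sqrt{ad-bc}\le\min\{d,c+d\}$. Write $\Phi(A;x)=\frac{ax+b}{cx+d}$, and $A^{\top}$ for the transpose of $A$. It is known that if $A\in\mathscr{M}$ then $\Phi(A;\cdot)$ is a strictly increasing $\phi$-contraction on $[0,1]$ for some comparison function $\phi$. A comparison function is an increasing map $\phi:[0,\infty)\to[0,\infty)$ such that $\lim_{n\to\infty}\phi^n(t)=0$ for every $t>0$ ($\phi^n$ is the $n$-fold iterate). A map $h:[0,1]\to[0,1]$ is a $\phi$-contraction if $|h(x)-h(y)|\le\phi(|x-y|)$ for all $x,y\in[0,1]$. A pair $\{h_0,h_1\}$ of maps on $[0,1]$ is a compatible system with comparison function $\phi$ if $h_0,h_1$ are strictly increasing $\phi$-contractions and $0=h_0(0)<h_0(1)=h_1(0)<h_1(1)=1$. It is an LF system if moreover $h_i=\Phi(A_i;\cdot)$ with $A_0,A_1\in\mathscr{M}$. In the setting of the claim, compatibility means $$0=b_{i,0}<\frac{a_{i,0}}{c_{i,0}+d_{i,0}}=\frac{b_{i,1}}{d_{i,1}}<\frac{a_{i,1}+b_{i,1}}{c_{i,1}+d_{i,1}}=1,\quad i=0,1;$$ in particular $a_{i,0}>0$ and $b_{i,1}>0$, the two expressions for $\alpha_i$ agree, and $b_{i,j}\alpha_i+d_{i,j}\ne0$, so that $\Phi(A_{i,j}^{\top};\alpha_i)=\frac{a_{i,j}\alpha_i+c_{i,j}}{b_{i,j}\alpha_i+d_{i,j}}$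 is well-defined. A function $\varphi$ on $[0,1]$ is called singular if $\varphi'(x)=0$ for Lebesgue-a.e. $x\in(0,1)$. The families $\{f_{i,j}\}$ and $\{g_{i,j}\}$ consist of strictly increasing $\phi$-contractions for a common comparison function $\phi$ and satisfy $0=h_{i,0}(0)<h_{i,0}(1)=h_{i,1}(0)<h_{i,1}(1)=1$ ($h=f,g$; $i=0,1$). The solution $(\varphi_0,\varphi_1)$ is constructed as follows. For $i_1,\dots,i_n\in\{0,1\}$ and $h\in\{f,g\}$ let $I^h_i(i_1,\dots,i_n)$ be the closed interval with endpoints $h_{i,i_1}\circ h_{i_1,i_2}\circ\cdots\circ h_{i_{n-1},i_n}(0)$ and $h_{i,i_1}\circ\cdots\circ h_{i_{n-1},i_n}(1)$. For $x_n\in\{0,1\}$ put $\varphi_i(f_{i,i_1}\circ\cdots\circ f_{i_{n-1},i_n}(x_n))=g_{i,i_1}\circ\cdots\circ g_{i_{n-1},i_n}(x_n)$; for any other $x\in[0,1]$ there is a unique sequence $(i_n)_n$ with $x\in I^f_i(i_1,\dots,i_n)$ for all $n$, and $\varphi_i(x)$ is the unique point of $\bigcap_{n\ge1}I^g_i(i_1,\dots,i_n)$. It is known that this is well-defined and that $(\varphi_0,\varphi_1)$ is the unique pair of increasing continuous maps $[0,1]\to[0,1]$ satisfying $g_{i,j}\circ\varphi_j=\varphi_i\circ f_{i,j}$ for all $i,j\in\{0,1\}$.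
   Formalization: In (ii) the printed c_{0,0} and c_{1,1} are replaced by c_{0,0}/a_{0,0} and c_{1,1}/b_{1,1}: the printed formulas are not invariant under rescaling the matrices and fail in general; they are right when a_{0,0}=1 and b_{1,1}=1. *)

(* Defs.v *)
From HB Require Import structures.
From mathcomp Require Import all_boot all_order all_algebra.
From mathcomp Require Import all_classical all_reals all_analysis.

Set Implicit Arguments.
Unset Strict Implicit.
Unset Printing Implicit Defensive.

Import Order.TTheory GRing.Theory Num.Theory.
Import numFieldNormedType.Exports.

Local Open Scope classical_set_scope.
Local Open Scope ring_scope.

(* Maps on [0,1] (resp. [0,oo)) are represented by total functions R -> R of
   which only the values on [0,1] (resp. [0,oo)) matter. "Increasing" means
   nondecreasing, as opposed to "strictly increasing". *)

Definition maps_I (R : realType) (h : R -> R) : Prop :=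
  forall x, x \in `[0, 1] -> h x \in `[0, 1].

Definition comparison_function (R : realType) (w : R -> R) : Prop :=
  [/\ forall t, 0 <= t -> 0 <= w t,
      forall s t, 0 <= s -> s <= t -> w s <= w t
    & forall t, 0 < t -> iter n w t @[n --> \oo] --> 0].

Definition phi_contraction (R : realType) (w h : R -> R) : Prop :=
  maps_I h /\
  forall x y, x \in `[0, 1] -> y \in `[0, 1] -> `|h x - h y| <= w `|x - y|.

Definition compatible_system (R : realType) (w h0 h1 : R -> R) : Prop :=
  [/\ {in `[0, 1] &, {homo h0 : x y / x < y}} /\ phi_contraction w h0,
      {in `[0, 1] &, {homo h1 : x y / x < y}} /\ phi_contraction w h1
    & [/\ h0 0 = 0, 0 < h0 1, h0 1 = h1 0, h1 0 < h1 1 & h1 1 = 1]].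

(* With A = (a b; c d): a = A 0 0, b = A 0 1, c = A 1 0, d = A 1 1.
   The class M, the map Phi A and the numbers alpha below are unchanged when a
   matrix is replaced by a positive multiple of itself, so a single entry such
   as c has an invariant meaning only relative to another one: c / a is the
   value of c once A is normalised by a = 1, and c / b once b = 1. *)

Definition classM (R : realType) (A : 'M[R]_2) : Prop :=
  [/\ 0 < A 0 0 + A 0 1 <= A 1 0 + A 1 1,
      0 <= A 0 1 < A 1 1,
      0 < A 0 0 * A 1 1 - A 0 1 * A 1 0
    & Num.sqrt (A 0 0 * A 1 1 - A 0 1 * A 1 0)
        <= Num.min (A 1 1) (A 1 0 + A 1 1)].

Definition Phi (R : realType) (A : 'M[R]_2) (x : R) : R :=
  (A 0 0 * x + A 0 1) / (A 1 0 * x + A 1 1).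

Definition LF_system (R : realType) (A0 A1 : 'M[R]_2) : Prop :=
  [/\ classM A0, classM A1
    & exists w, comparison_function w /\ compatible_system w (Phi A0) (Phi A1)].

Definition dyadic_map (R : realType) (i j : 'I_2) (x : R) : R :=
  if j == 0 then x / 2 else (x + 1) / 2.

Definition alpha (R : realType) (A : 'I_2 -> 'I_2 -> 'M[R]_2) (i : 'I_2) : R :=
  ((A i 0) 1 0 + (A i 0) 1 1) / (A i 0) 0 0 - 2.

Lemma alphaE (R : realType) (A : 'I_2 -> 'I_2 -> 'M[R]_2) (i : 'I_2) :
  LF_system (A i 0) (A i 1) -> alpha A i = (A i 1) 1 1 / (A i 1) 0 1 - 2.
Proof.
case=> -[_ /andP[b_ge0 b_lt_d] _ _] _ [w [_ [_ _ []]]].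
rewrite /alpha /Phi !mulr0 !mulr1 !add0r => /eqP.
rewrite mulf_eq0 invr_eq0 (gt_eqF (le_lt_trans b_ge0 b_lt_d)) orbF => /eqP->.
by rewrite addr0 => _ h01 _ _; rewrite -invf_div h01 invf_div.
Qed.

Definition singular (R : realType) (F : R -> R) : Prop :=
  {ae lebesgue_measure, forall x : R, x \in `]0, 1[ -> is_derive x 1 F 0}.

(* Smoothness on the closed interval: F extends to a C^oo function on an open
   neighbourhood of [0,1]. *)
Definition smooth_I (R : realType) (F : R -> R) : Prop :=
  exists (U : set R) (G : R -> R),
    [/\ open U, `[0, 1] `<=` U,
        forall x, x \in `[0, 1] -> G x = F x
      & forall n x, U x -> derivable (derive1n n G) x 1].

(* Main.v *)
Require Import Defs.
From HB Require Import structures.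
From mathcomp Require Import all_boot all_order all_algebra.
From mathcomp Require Import all_classical all_reals all_analysis.
From mathcomp Require Import zify ring lra.

Set Implicit Arguments.
Unset Strict Implicit.
Unset Printing Implicit Defensive.

Import Order.TTheory GRing.Theory Num.Theory.
Import numFieldNormedType.Exports.

Local Open Scope classical_set_scope.
Local Open Scope ring_scope.

(** Post-composing the branch of a product of matrices [A i j] with an affine
    map turns it into the Moebius map [mob u], where [u - 1] is the image of [0]
    under the corresponding composition of the maps [Phi (A i j)^T].  The curve
    [mob u \o phi i] assigns to the two halves of [0, 1] the masses
    [p = u / (u + beta)] and [1 - p], [beta = alpha i + 1], and on each half it is
    again a rescaled curve [mob u' \o phi j].

    If all [Phi (A i j)^T] map [alpha i] to [alpha j], then starting from
    [u = beta] every split is fair, so [mob beta \o phi i] is the identity.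

    Otherwise, for one pair [(i, j)] and every [u], the split at [i] or the next
    one at [j] is unfair by a fixed amount.  Since
    [sqrt p + sqrt (1 - p) <= sqrt 2] with equality only for [p = 1 / 2], the
    sum of the square roots of the increments of [phi k] over the [8 ^ m] cells
    of level [m] is at most [(8 kappa) ^ (m / 2)] with [kappa < 1].  By Chebyshev
    the cells with slope above [e] have total length [O(kappa ^ (m / 2))], and
    Borel-Cantelli gives derivative [0] almost everywhere. *)

(** * The maps [mob u] and the weight of the left half *)

Lemma ord2_eq0_or1 (j : 'I_2) : j = 0 \/ j = 1.
Proof. by case: j => -[|[|//]] ?; [left|right]; apply/val_inj. Qed.

(* The Moebius map of [0, 1] multiplying the odds [y / (1 - y)] by [u]. *)
Definition mob (R : realType) (u y : R) : R := u * y / (u * y + 1 - y).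

(** The value of [mob u] at [1 / (1 + b)], which for [b = beta] is the cut point [Phi (A i 0) 1]. *)
Definition prob (R : realType) (b u : R) : R := u / (u + b).

(* The action of [Phi A^T] in the coordinate [u = z + 1]. *)
Definition upd (R : realType) (A : 'M[R]_2) (u : R) : R := Phi A^T (u - 1) + 1.

Lemma mob_den_gt0 (R : realType) (u y : R) :
  0 < u -> 0 <= y <= 1 -> 0 < u * y + 1 - y.
Proof.
move=> u0 /andP[y0 y1]; have [->|yN1] := eqVneq y 1; first by rewrite mulr1; lra.
have : y < 1 by rewrite lt_neqAle yN1.
by have : 0 <= u * y by [rewrite mulr_ge0// ltW]; lra.
Qed.

Lemma mob_itv (R : realType) (u y : R) :
  0 < u -> 0 <= y <= 1 -> 0 <= mob u y <= 1.
Proof.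
move=> u0 y01; have D := mob_den_gt0 u0 y01; have /andP[y0 y1] := y01.
have uy : 0 <= u * y by rewrite mulr_ge0// ltW.
by rewrite /mob divr_ge0 ?(ltW D)//= ler_pdivrMr// mul1r; lra.
Qed.

Lemma mob1 (R : realType) (y : R) : mob 1 y = y.
Proof. by rewrite /mob mul1r addrAC subrr add0r divr1. Qed.

Lemma prob_itv (R : realType) (b u : R) : 0 < b -> 0 < u -> 0 <= prob b u <= 1.
Proof.
move=> b0 u0; have D : 0 < u + b by lra.
by rewrite /prob divr_ge0 ?(ltW D) ?(ltW u0)//= ler_pdivrMr// mul1r; lra.
Qed.

(** * Composition of one branch with [mob u] *)

Section LF.
Variables (R : realType) (A : 'I_2 -> 'I_2 -> 'M[R]_2) (i : 'I_2).
Hypothesis hLF : LF_system (A i 0) (A i 1).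

(** The ratio of the right to the left part of [0, 1] cut at [Phi (A i 0) 1]; it is also [alpha] in
    the coordinate used by [upd]. *)
Definition beta : R := alpha A i + 1.

(** [Phi (A i 0)] fixes 0, which forces [b = 0], and its value [a / (c + d)] at 1 is below 1. *)
Lemma LF_entries0 : [/\ A i 0 0 1 = 0, 0 < A i 0 0 0, 0 < A i 0 1 1
  & A i 0 0 0 < A i 0 1 0 + A i 0 1 1].
Proof.
case: hLF => -[/andP[ab abcd] /andP[b0 bd] _ _] _ [w [_ [_ _ [h0 h1 h2 h3 h4]]]].
have d0 : 0 < A i 0 1 1 by lra.
have b_eq0 : A i 0 0 1 = 0.
  move: h0; rewrite /Phi !mulr0 !add0r => /eqP.
  by rewrite mulf_eq0 invr_eq0 (gt_eqF d0) orbF => /eqP.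
rewrite b_eq0 addr0 in ab abcd; split => //.
move: h3; rewrite -h2 h4 /Phi !mulr1 b_eq0 addr0 ltr_pdivrMr ?mul1r//.
exact: lt_le_trans abcd.
Qed.

Lemma LF_entries1 : [/\ 0 < A i 1 0 1, A i 1 0 1 < A i 1 1 1,
  0 < A i 1 1 0 + A i 1 1 1 & A i 1 0 0 + A i 1 0 1 = A i 1 1 0 + A i 1 1 1].
Proof.
case: hLF => _ [/andP[ab abcd] /andP[b0 bd] _ _] [w [_ [_ _ [h0 h1 h2 h3 h4]]]].
have d0 : 0 < A i 1 1 1 by lra.
have cd0 : 0 < A i 1 1 0 + A i 1 1 1 by lra.
split => //.
  by move: h1; rewrite h2 /Phi !mulr0 !add0r pmulr_lgt0 ?invr_gt0.
by move: h4; rewrite /Phi !mulr1 => /divr1_eq.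
Qed.

Lemma beta0E : beta = (A i 0 1 0 + A i 0 1 1 - A i 0 0 0) / A i 0 0 0.
Proof.
have [_ a0 _ _] := LF_entries0.
by rewrite /beta /alpha; field; rewrite gt_eqF.
Qed.

Lemma beta1E : beta = (A i 1 1 1 - A i 1 0 1) / A i 1 0 1.
Proof.
have [b0 _ _ _] := LF_entries1.
by rewrite /beta alphaE//; field; rewrite gt_eqF.
Qed.

Lemma beta_gt0 : 0 < beta.
Proof.
have [_ a0 _ h] := LF_entries0.
by rewrite beta0E divr_gt0// subr_gt0.
Qed.

Lemma upd0E u : upd (A i 0) u =
  (A i 0 0 0 * u + (A i 0 1 0 + A i 0 1 1 - A i 0 0 0)) / A i 0 1 1.
Proof.
have [b0 _ d0 _] := LF_entries0.
by rewrite /upd /Phi !mxE b0 mul0r add0r; field; rewrite gt_eqF.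
Qed.

Lemma upd1_den_gt0 u : 0 < u ->
  0 < A i 1 0 1 * u + (A i 1 1 1 - A i 1 0 1).
Proof.
have [b0 bd _ _] := LF_entries1 => u0.
by rewrite addr_gt0 ?subr_gt0// mulr_gt0.
Qed.

(** As [Phi (A i 1)] fixes 1, [a + b = c + d], and the constant term of the numerator cancels. *)
Lemma upd1E u : 0 < u -> upd (A i 1) u =
  (A i 1 1 0 + A i 1 1 1) * u / (A i 1 0 1 * u + (A i 1 1 1 - A i 1 0 1)).
Proof.
move=> u0; have D := upd1_den_gt0 u0.
have [_ _ _ eq_abcd] := LF_entries1.
have -> : A i 1 1 0 + A i 1 1 1 = A i 1 0 0 + A i 1 0 1 by [].
rewrite /upd /Phi !mxE.
have -> : A i 1 1 0 = A i 1 0 0 + A i 1 0 1 - A i 1 1 1 by lra.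
by field; lra.
Qed.

Lemma upd_gt0 j u : 0 < u -> 0 < upd (A i j) u.
Proof.
move=> u0; have [b0 a0 d0 h] := LF_entries0; have [b1 bd cd _] := LF_entries1.
case: (ord2_eq0_or1 j) => ->.
  by rewrite upd0E divr_gt0// addr_gt0 ?mulr_gt0 ?subr_gt0.
by rewrite upd1E// divr_gt0 ?upd1_den_gt0// mulr_gt0.
Qed.

(** Both sides are Moebius in [y] and vanish at 0. Since [mob] fixes 0 and 1, the factor is the
    value at 1, and [upd] is the one parameter left. *)
Lemma mob_Phi0 u y : 0 < u -> 0 <= y <= 1 ->
  mob u (Phi (A i 0) y) = prob beta u * mob (upd (A i 0) u) y.
Proof.
move=> u0 y01; have u'0 := upd_gt0 0 u0.
have D := mob_den_gt0 u'0 y01; have /andP[y0 y1] := y01.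
have [b0 a0 d0 h] := LF_entries0.
move: D; rewrite /mob /prob beta0E upd0E /Phi b0.
move: (A i 0 0 0) (A i 0 1 0) (A i 0 1 1) a0 d0 h => a c d a0 d0 h.
have -> : (a * u + (c + d - a)) / d * y + 1 - y =
    (u * a * y + (c - a) * y + d) / d by field; lra.
rewrite pmulr_lgt0 ?invr_gt0// => D.
have ua0 : 0 < u * a by exact: mulr_gt0.
(* This is a convex combination of the positive numbers [c + d] and [d]. *)
have E : 0 < c * y + d.
  have [->|yN1] := eqVneq y 1; first lra.
  have y1' : y < 1 by rewrite lt_neqAle yN1.
  have : 0 < (c + d) * y + d * (1 - y); last by lra.
  by rewrite ltr_wpDl ?mulr_ge0 ?mulr_gt0 ?subr_gt0//; lra.
field; do ?[apply/andP; split]; lra.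
Qed.

(** The second branch sends 0 to the cut point and fixes 1, so rescaling the image to [0, 1] leaves
    a Moebius map fixing both ends. *)
Lemma mob_Phi1 u y : 0 < u -> 0 <= y <= 1 ->
  mob u (Phi (A i 1) y) =
  prob beta u + (1 - prob beta u) * mob (upd (A i 1) u) y.
Proof.
move=> u0 y01; have u'0 := upd_gt0 1 u0.
have D := mob_den_gt0 u'0 y01; have /andP[y0 y1] := y01.
have D' := upd1_den_gt0 u0; have [b0 bd cd eq_abcd] := LF_entries1.
move: D; rewrite /mob /prob beta1E upd1E// /Phi.
have -> : A i 1 0 0 = A i 1 1 0 + A i 1 1 1 - A i 1 0 1 by lra.
move: (A i 1 0 1) (A i 1 1 0) (A i 1 1 1) b0 bd cd D' => b c d b0 bd cd D'.
have -> : (c + d) * u / (b * u + (d - b)) * y + 1 - y =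
    (u * ((c + d - b) * y + b) + (d - b) * (1 - y)) / (b * u + (d - b)).
  by field; lra.
rewrite pmulr_lgt0 ?invr_gt0// => D.
have E : 0 < c * y + d.
  have [->|yN1] := eqVneq y 1; first lra.
  have y1' : y < 1 by rewrite lt_neqAle yN1.
  have : 0 < (c + d) * y + d * (1 - y); last by lra.
  by rewrite ltr_wpDl ?mulr_ge0 ?mulr_gt0 ?subr_gt0//; lra.
field; do ?[apply/andP; split]; lra.
Qed.

End LF.

(** * Square-root variation over equal cells *)

(** For nondecreasing [G] of total mass at most 1, Cauchy-Schwarz bounds this by the square root of
    [n]; slower growth means that the mass concentrates on few cells. *)
Definition root_variation (R : realType) (G : R -> R) (n : nat) : R :=
  \sum_(k < n) Num.sqrt (G (k.+1%:R / n%:R) - G (k%:R / n%:R)).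

Lemma root_variation_ge0 (R : realType) (G : R -> R) n : 0 <= root_variation G n.
Proof. by apply: sumr_ge0 => k _; exact: sqrtr_ge0. Qed.

Lemma ratio_itv (R : realType) (k n : nat) : (0 < n)%N -> (k <= n)%N ->
  (k%:R / n%:R : R) \in `[0, 1].
Proof.
move=> n0 kn; rewrite in_itv/= divr_ge0//= ler_pdivrMr ?ltr0n// mul1r.
by rewrite ler_nat.
Qed.

Lemma root_variation_double (R : realType) (G G0 G1 : R -> R) (p : R) n :
  (0 < n)%N -> 0 <= p <= 1 ->
  (forall x, x \in `[0, 1] -> G (x / 2) = p * G0 x) ->
  (forall x, x \in `[0, 1] -> G ((x + 1) / 2) = p + (1 - p) * G1 x) ->
  root_variation G (n + n) =
  Num.sqrt p * root_variation G0 n + Num.sqrt (1 - p) * root_variation G1 n.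
Proof.
move=> n0 /andP[p0 p1] GE0 GE1; have nN0 : n%:R != 0 :> R by rewrite pnatr_eq0 -lt0n.
rewrite /root_variation big_split_ord/= !mulr_sumr; congr (_ + _).
  (* [Num.sqrt] is 0 on negative numbers, so a nonnegative factor comes out whatever the sign of the
     increment. *)
  apply: eq_bigr => k _; rewrite -sqrtrM//; congr (Num.sqrt _).
  have E (m : nat) : (m%:R / (n + n)%:R : R) = m%:R / n%:R / 2.
    by rewrite natrD; field; lra.
  by rewrite (E k.+1) (E k) !GE0 ?mulrBr// ratio_itv// ltnW.
apply: eq_bigr => k _; rewrite -sqrtrM ?subr_ge0//; congr (Num.sqrt _).
have E (m : nat) : ((n + m)%:R / (n + n)%:R : R) = (m%:R / n%:R + 1) / 2.
  by rewrite !natrD; field; lra.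
by rewrite -addnS (E k.+1) (E k) !GE1 ?ratio_itv// 1?ltnW//; ring.
Qed.

(** Cauchy-Schwarz with the unit vector of entries [Num.sqrt p] and [Num.sqrt (1 - p)]; the defect
    is an explicit square. *)
Lemma sqr_sqrt_comb_le (R : realType) (p x y : R) : 0 <= p <= 1 ->
  (Num.sqrt p * x + Num.sqrt (1 - p) * y) ^+ 2 <= x ^+ 2 + y ^+ 2.
Proof.
move=> /andP[p0 p1]; have := sqr_sqrtr p0.
have /sqr_sqrtr : 0 <= 1 - p by lra.
move: (Num.sqrt p) (Num.sqrt (1 - p)) => s t t2 s2.
rewrite -subr_ge0 (_ : _ - _ = (t * x - s * y) ^+ 2) ?sqr_ge0//.
have -> : x ^+ 2 + y ^+ 2 = (s ^+ 2 + t ^+ 2) * (x ^+ 2 + y ^+ 2).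
  by rewrite s2 t2; ring.
by ring.
Qed.

(* [1 - 4 p (1 - p)] is the square of the relative bias of the weights. *)
Lemma sqr_sqrt_comb_le_biased (R : realType) (p x y C d : R) : 0 <= p <= 1 ->
  0 <= x -> 0 <= y -> x ^+ 2 <= C -> y ^+ 2 <= C -> 4 * p * (1 - p) <= 1 - d ->
  (Num.sqrt p * x + Num.sqrt (1 - p) * y) ^+ 2 <= (1 + Num.sqrt (1 - d)) * C.
Proof.
move=> /andP[p0 p1] x0 y0 xC yC pd; have q0 : 0 <= 1 - p by lra.
have st : 2 * (Num.sqrt p * Num.sqrt (1 - p)) <= Num.sqrt (1 - d).
  have h : 0 <= 2 * Num.sqrt (p * (1 - p)) by rewrite mulr_ge0// sqrtr_ge0.
  rewrite -sqrtrM// -(ger0_norm h) -sqrtr_sqr ler_wsqrtr//.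
  by rewrite exprMn sqr_sqrtr ?mulr_ge0//; lra.
have xyC : x * y <= C.
  have : 0 <= (x - y) ^+ 2 by exact: sqr_ge0.
  by rewrite sqrrB -mulr_natl; lra.
have := sqr_sqrtr p0; have := sqr_sqrtr q0.
have := sqrtr_ge0 p; have := sqrtr_ge0 (1 - p).
move: (Num.sqrt p) (Num.sqrt (1 - p)) st => s t st t0 s0 t2 s2.
(* The first two terms form a weighted mean of [x ^+ 2] and [y ^+ 2]; the gain comes from the cross
   term. *)
have -> : (s * x + t * y) ^+ 2 = s ^+ 2 * x ^+ 2 + t ^+ 2 * y ^+ 2
  + 2 * (s * t) * (x * y) by ring.
have C0 : 0 <= C by apply: le_trans xC; exact: sqr_ge0.
have h1 : s ^+ 2 * x ^+ 2 + t ^+ 2 * y ^+ 2 <= C.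
  apply: (@le_trans _ _ (s ^+ 2 * C + t ^+ 2 * C)).
    by rewrite lerD// ler_wpM2l// sqr_ge0.
  by rewrite s2 t2; lra.
rewrite [leRHS]mulrDl mul1r lerD// (le_trans (ler_wpM2l _ xyC)) ?ler_wpM2r//.
by rewrite !mulr_ge0.
Qed.

(** The square of the difference of the two weights [prob b u] and [1 - prob b u]. *)
Definition bias (R : realType) (b u : R) : R := ((u - b) / (u + b)) ^+ 2.

Lemma prob_bias (R : realType) (b u : R) : 0 < b -> 0 < u ->
  4 * prob b u * (1 - prob b u) = 1 - bias b u.
Proof. by move=> b0 u0; rewrite /prob /bias; field; lra. Qed.

Lemma bias_le1 (R : realType) (b u : R) : 0 < b -> 0 < u -> bias b u <= 1.
Proof.
move=> b0 u0; have /andP[p0 p1] := prob_itv b0 u0.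
have := prob_bias b0 u0.
have : 0 <= prob b u * (1 - prob b u) by rewrite mulr_ge0 ?subr_ge0.
by lra.
Qed.

(** The bias grows as [u] moves away from [b] on either side, and the worst case at distance [e] is
    [u = b + e]. *)
Lemma bias_ge_dist (R : realType) (b u e : R) : 0 < b -> 0 < u -> 0 < e ->
  e <= `|u - b| -> (e / (2 * b + e)) ^+ 2 <= bias b u.
Proof.
move=> b0 u0 e0 eub; have D : 0 < u + b by lra. have D' : 0 < 2 * b + e by lra.
rewrite /bias -[leRHS]real_normK ?num_real// ler_sqr ?nnegrE// ?divr_ge0 ?(ltW D') ?(ltW e0)//.
rewrite normrM normfV (gtr0_norm D) ler_pdivrMr// mulrAC ler_pdivlMr//.
move: eub; rewrite ler_normr => /orP[] h.
  rewrite ger0_norm; last lra.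
  have : 0 <= b * (u - b - e) by rewrite mulr_ge0; lra.
  by lra.
rewrite ler0_norm; last lra.
have : 0 <= b * (b - u - e) by rewrite mulr_ge0; lra.
have : 0 <= e * (b - u) by rewrite mulr_ge0; lra.
have := mulr_gt0 e0 u0.
by lra.
Qed.

(** * Growth of the square-root variation along the recursion *)

Section contraction.
Variables (R : realType) (A : 'I_2 -> 'I_2 -> 'M[R]_2) (phi : 'I_2 -> R -> R).
Hypothesis hLF : forall i, LF_system (A i 0) (A i 1).
Hypothesis phi_I : forall i, maps_I (phi i).
Hypothesis phi_eq : forall i j x, x \in `[0, 1] ->
  Phi (A i j) (phi j x) = phi i (dyadic_map i j x).

Lemma mob_phi0 i u x : 0 < u -> x \in `[0, 1] ->
  mob u (phi i (x / 2)) = prob (beta A i) u * mob (upd (A i 0) u) (phi 0 x).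
Proof.
move=> u0 x01; rewrite -(mob_Phi0 (hLF i) u0).
  by rewrite phi_eq.
by have := phi_I 0 x01; rewrite in_itv.
Qed.

Lemma mob_phi1 i u x : 0 < u -> x \in `[0, 1] ->
  mob u (phi i ((x + 1) / 2)) =
  prob (beta A i) u + (1 - prob (beta A i) u) * mob (upd (A i 1) u) (phi 1 x).
Proof.
move=> u0 x01; rewrite -(mob_Phi1 (hLF i) u0).
  by rewrite phi_eq.
by have := phi_I 1 x01; rewrite in_itv.
Qed.

Let rv i u n := root_variation (mob u \o phi i) n.

Lemma rv_double i u n : (0 < n)%N -> 0 < u ->
  rv i u (n + n) = Num.sqrt (prob (beta A i) u) * rv 0 (upd (A i 0) u) n
                 + Num.sqrt (1 - prob (beta A i) u) * rv 1 (upd (A i 1) u) n.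
Proof.
move=> n0 u0; apply: root_variation_double => //.
- exact/prob_itv/u0/beta_gt0.
- by move=> x x01 /=; rewrite mob_phi0.
- by move=> x x01 /=; rewrite mob_phi1.
Qed.

(** Uniformity in [i] and [u] lets the bound be iterated, because the recursion changes both. *)
Definition rv_bounded n C := forall i u, 0 < u -> rv i u n ^+ 2 <= C.

(** The branch [j] is kept explicit, so that a gain found further down that branch is not lost. *)
Lemma rv_double_le i j u n C : (0 < n)%N -> 0 < u -> rv_bounded n C ->
  rv i u (n + n) ^+ 2 <= rv j (upd (A i j) u) n ^+ 2 + C.
Proof.
move=> n0 u0 hC; rewrite rv_double//.
apply: (le_trans (sqr_sqrt_comb_le _ _ (prob_itv (beta_gt0 (hLF i)) u0))).
have hj k : rv k (upd (A i k) u) n ^+ 2 <= C by apply/hC/upd_gt0.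
have: j = 0 \/ j = 1 by case: j => -[|[|//]] ?; [left|right]; apply/val_inj.
by case=> ->; [rewrite lerD2l | rewrite addrC lerD2l]; apply: hj.
Qed.

Lemma rv_bounded_double n C : (0 < n)%N -> rv_bounded n C ->
  rv_bounded (n + n) (2 * C).
Proof.
move=> n0 hC i u u0; apply: le_trans (rv_double_le i 0 n0 u0 hC) _.
by rewrite mulr2n mulrDl mul1r lerD2r hC// upd_gt0.
Qed.

Lemma rv_double_biased i u n C d : (0 < n)%N -> 0 < u -> rv_bounded n C ->
  d <= bias (beta A i) u -> rv i u (n + n) ^+ 2 <= (1 + Num.sqrt (1 - d)) * C.
Proof.
move=> n0 u0 hC du; have b0 := beta_gt0 (hLF i).
rewrite rv_double//; apply: sqr_sqrt_comb_le_biased.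
- exact: prob_itv.
- exact: root_variation_ge0.
- exact: root_variation_ge0.
- by apply: hC; exact: upd_gt0.
- by apply: hC; exact: upd_gt0.
- by rewrite prob_bias//; lra.
Qed.

Lemma upd_continuous i j (u : R) : 0 < u -> {for u, continuous (upd (A i j))}.
Proof.
move=> u0; have b0 : 0 < (A i j) 0 1 * (u - 1) + (A i j) 1 1.
  case: (ord2_eq0_or1 j) => ->; first by have [-> _ d0 _] := LF_entries0 (hLF i); rewrite mul0r add0r.
  by have := upd1_den_gt0 (hLF i) u0; lra.
have aff (a b : R) : {for u, continuous (fun v : R => a * (v - 1) + b)}.
  apply: cvgD; last exact: cvg_cst.
  by apply: cvgM; [exact: cvg_cst | apply: cvgB; [exact: cvg_id | exact: cvg_cst]].
rewrite /upd /Phi !mxE; apply: cvgD; last exact: cvg_cst.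
apply: cvgM; first exact: aff.
by apply: cvgV; [rewrite gt_eqF | exact: aff].
Qed.

(** If [u] is far from [beta A i], the split at [i] is unfair. If it is near, continuity keeps
    [upd (A i j) u] away from [beta A j], and the split at [j] is unfair. *)
Lemma bias_gap i j : upd (A i j) (beta A i) != beta A j ->
  exists2 d, 0 < d <= 1 & forall u, 0 < u ->
    d <= bias (beta A i) u \/ d <= bias (beta A j) (upd (A i j) u).
Proof.
have bi0 := beta_gt0 (hLF i); have bj0 := beta_gt0 (hLF j).
have U0 := upd_gt0 (hLF i) j; have V0 := U0 _ bi0.
have Vc : {for beta A i, continuous (upd (A i j))} by exact: upd_continuous.
set V := upd _ in U0 V0 Vc * => neq; pose r := bias (beta A j) \o V.
have r0 : 0 < r (beta A i).
  rewrite /r /= /bias exprn_even_gt0//= mulf_neq0 ?subr_eq0// invr_eq0 gt_eqF//.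
  by rewrite addr_gt0.
have rc : {for beta A i, continuous r}.
  rewrite /r /bias /=; apply: (@continuous_comp _ _ _ _ (fun z : R => z ^+ 2)).
    apply: cvgM; first by apply: cvgB => //; exact: cvg_cst.
    apply: cvgV; first by rewrite gt_eqF// addr_gt0.
    by apply: cvgD => //; exact: cvg_cst.
  exact: exprn_continuous.
have /cvgrPdist_lt/(_ (r (beta A i) / 2)) := rc.
rewrite divr_gt0// => /(_ isT)/nbhs_ballP[e /= e0 he].
(* The first entry serves [u] at distance at least [e], the second the ball of radius [e], where [r]
   stays above half its central value. *)
exists (Num.min ((e / (2 * beta A i + e)) ^+ 2) (r (beta A i) / 2)).
  have D : 0 < 2 * beta A i + e by lra.
  rewrite lt_min exprn_gt0; last exact: divr_gt0.
  rewrite (divr_gt0 r0)//= ge_min; apply/orP; right.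
  have : r (beta A i) <= 1 by exact: bias_le1.
  by lra.
move=> u u0; have [ue|ue] := leP e `|u - beta A i|.
  by left; rewrite ge_min bias_ge_dist.
right; rewrite ge_min; apply/orP; right.
have : `|r (beta A i) - r u| < r (beta A i) / 2.
  by apply: he; rewrite /ball /= distrC.
by rewrite ltr_distl => /andP[_]; rewrite (_ : bias _ _ = r u)//; lra.
Qed.

(** Three doublings are used: one to enter [i] from any [k], then the splits at [i] and [j], one of
    which is unfair. Without bias the factor would be 8. *)
Lemma rv_bounded_octuple i j d n C : (0 < n)%N -> rv_bounded n C -> 0 <= d ->
  (forall u, 0 < u ->
    d <= bias (beta A i) u \/ d <= bias (beta A j) (upd (A i j) u)) ->
  rv_bounded (8 * n) ((7 + Num.sqrt (1 - d)) * C).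
Proof.
move=> n0 hC d0 gap k u u0; have hC2 := rv_bounded_double n0 hC.
have C0 : 0 <= C by apply: le_trans (hC i 1 ltr01); exact: sqr_ge0.
have nn0 : (0 < n + n)%N by rewrite addn_gt0 n0.
have hC4 := rv_bounded_double nn0 hC2.
have -> : (8 * n = ((n + n) + (n + n)) + ((n + n) + (n + n)))%N.
  by rewrite !addnn -!mul2n !mulnA.
have nnnn0 : (0 < n + n + (n + n))%N by rewrite addn_gt0 nn0.
apply: le_trans (rv_double_le k i nnnn0 u0 hC4) _.
have v0 : 0 < upd (A k i) u by exact: upd_gt0.
move: (upd _ _) v0 => v v0.
(* The other branch of the first split accounts for the remaining [4 * C]. *)
suff : rv i v (n + n + (n + n)) ^+ 2 <= (3 + Num.sqrt (1 - d)) * C by lra.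
case: (gap v v0) => h.
  apply: le_trans (rv_double_biased nn0 v0 hC2 h) _.
  suff : Num.sqrt (1 - d) * C <= 1 * C by lra.
  rewrite ler_wpM2r// -[leRHS]sqrtr1 ler_wsqrtr//.
  by lra.
apply: le_trans (rv_double_le i j nn0 v0 hC2) _.
have := rv_double_biased n0 (upd_gt0 (hLF i) j v0) hC h.
by lra.
Qed.

End contraction.

(** * Derivative zero almost everywhere from small square-root variation *)

Lemma sqrtrX_nneg (R : realType) (x : R) n : 0 <= x ->
  Num.sqrt (x ^+ n) = Num.sqrt x ^+ n.
Proof.
move=> x0; elim: n => [|n IHn]; first by rewrite !expr0 sqrtr1.
by rewrite !exprS sqrtrM// IHn.
Qed.

Section singular_criterion.
Variables (R : realType) (F : R -> R) (q : nat).
Hypothesis q_gt1 : (1 < q)%N.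
Hypothesis F_incr : {in `[0, 1] &, {homo F : x y / x <= y}}.

Let increment n l := F (l.+1%:R / n%:R) - F (l%:R / n%:R).

(* Both neighbours of each steep cell are included, so that outside this set
   the whole [1/n]-neighbourhood of a point is made of flat cells. *)
Definition steep_cells (e : R) (n : nat) : set R :=
  \big[setU/set0]_(l < n)
    if e / n%:R < increment n l then `[(l%:R - 1) / n%:R, (l%:R + 2) / n%:R]%classic
    else set0.

Lemma measurable_steep_cells e n : measurable (steep_cells e n).
Proof. by apply: bigsetU_measurable => l _; case: ifP. Qed.

(** Chebyshev: on a steep cell the root of the increment exceeds [Num.sqrt (e / n%:R)], and each
    enlarged cell has length [3 / n%:R]. *)
Lemma steep_cells_measure e n : 0 < e -> (0 < n)%N ->
  (lebesgue_measure (steep_cells e n) <=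
   (3 / n%:R / Num.sqrt (e / n%:R) * root_variation F n)%:E)%E.
Proof.
move=> e0 n0; have n0' : 0 < n%:R :> R by rewrite ltr0n.
pose S (l : nat) : set R := if e / n%:R < increment n l
  then `[(l%:R - 1) / n%:R, (l%:R + 2) / n%:R]%classic else set0.
have mS l : measurable (S l) by rewrite /S; case: ifP.
apply: le_trans (Boole_inequality (@lebesgue_measure R) (A := S) _) _.
  by move=> l _; exact: mS.
rewrite /root_variation mulr_sumr -sumEFin; apply: lee_sum => l _; rewrite /S.
have en : 0 < Num.sqrt (e / n%:R) by rewrite sqrtr_gt0 divr_gt0.
case: ifPn => [steep|_]; last first.
  by rewrite measure0 lee_fin !mulr_ge0 ?sqrtr_ge0 ?invr_ge0 ?(ltW en) ?(ltW n0').
rewrite [leLHS]lebesgue_measure_itv/= lte_fin ltr_pM2r ?invr_gt0//.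
rewrite ifT; last lra.
rewrite -EFinD lee_fin -mulrBl (_ : l%:R + 2 - (l%:R - 1) = 3); last by ring.
rewrite -[leLHS]mulr1 -[leRHS]mulrA ler_wpM2l ?divr_ge0 ?(ltW n0')//.
by rewrite mulrC ler_pdivlMr// mul1r ler_wsqrtr// ltW.
Qed.

(** The cell of [x] and its two neighbours are flat and cover all points within [1 / n] of [x];
    monotonicity then adds up three increments. *)
Lemma not_steep_cells e n x y : 0 < n%:R :> R -> 2 / n%:R <= x <= 1 - 2 / n%:R ->
  ~ steep_cells e n x -> `|y - x| <= n%:R^-1 ->
  `|F y - F x| <= 3 * e / n%:R.
Proof.
move=> n0 /andP[x2 x1] xNS yx.
have {}x2 : 2 <= n%:R * x by rewrite mulrC -ler_pdivrMr.
have {}x1 : n%:R * x + 2 <= n%:R.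
  have := ler_wpM2l (ltW n0) x1.
  by rewrite mulrBr mulr1 mulrCA divff ?gt_eqF// mulr1; lra.
have nx0 : 0 <= n%:R * x by lra.
have /andP[lx xl] := truncn_itv nx0.
have : (1 <= Num.truncn (n%:R * x))%N by rewrite truncn_ge_nat//; lra.
(* The cell of [x] has index [l.+1], so its neighbours are [l] and [l.+2]; the margins [2 / n%:R]
   keep both inside [0, 1]. *)
case E : (Num.truncn _) lx xl => [//|l] lx xl _.
have lnat : l.+1.+2%:R = l%:R + 3 :> R by rewrite -addn3 natrD.
have l2 : l.+2%:R = l%:R + 2 :> R by rewrite -addn2 natrD.
have l1 : l.+1%:R = l%:R + 1 :> R by rewrite -addn1 natrD.
have ln : (l.+2 < n)%N by rewrite -(ltr_nat R); lra.
have flat k : (k < n)%N -> k%:R - 1 <= n%:R * x <= k%:R + 2 ->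
    increment n k <= e / n%:R.
  move=> kn /andP[kx xk]; rewrite leNgt; apply/negP => steep; apply: xNS.
  rewrite /steep_cells -(@bigcup_mkord _ n (fun l => if e / n%:R < increment n l
    then `[(l%:R - 1) / n%:R, (l%:R + 2) / n%:R]%classic else set0)).
  exists k => //=; rewrite steep /= in_itv/=.
  by rewrite ler_pdivrMr// ler_pdivlMr// ![x * _]mulrC kx.
have f0 : increment n l <= e / n%:R by apply: (flat _ (ltnW (ltnW ln))); lra.
have f1 : increment n l.+1 <= e / n%:R by apply: (flat _ (ltnW ln)); lra.
have f2 : increment n l.+2 <= e / n%:R by apply: (flat _ ln); lra.
rewrite /increment in f0 f1 f2.
have /andP[yx1 yx2] : n%:R * x - 1 <= n%:R * y <= n%:R * x + 1.
  move: yx; rewrite -[n%:R^-1]mul1r ler_pdivlMr// -{1}(gtr0_norm n0) -normrM.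
  by rewrite ler_norml => /andP[]; lra.
have between z : n%:R * x - 1 <= n%:R * z <= n%:R * x + 1 ->
    F (l%:R / n%:R) <= F z <= F (l.+3%:R / n%:R).
  move=> /andP[z1 z2].
  have lz : l%:R / n%:R <= z by rewrite ler_pdivrMr// mulrC; lra.
  have zl : z <= l.+3%:R / n%:R by rewrite ler_pdivlMr// mulrC; lra.
  have nn0 := leq_ltn_trans (leq0n _) ln.
  have l01 := ratio_itv R nn0 (ltnW (ltnW (ltnW ln))).
  have l31 := ratio_itv R nn0 ln.
  have z01 : z \in `[(0:R), 1].
    move: l01 l31; rewrite !in_itv/= => /andP[h _] /andP[_ h'].
    by rewrite (le_trans h lz) (le_trans zl h').
  by rewrite !F_incr.
have /andP[Fy1 Fy2] : F (l%:R / n%:R) <= F y <= F (l.+3%:R / n%:R).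
  by apply: between; rewrite yx1.
have /andP[Fx1 Fx2] : F (l%:R / n%:R) <= F x <= F (l.+3%:R / n%:R).
  by apply: between; lra.
rewrite -mulrA ler_norml; lra.
Qed.

(** An increment [h] is compared with the cells whose width lies between [|h|] and [q * |h|]; this
    costs only a factor [q] in the slope. *)
Lemma is_derive_flat x : 0 < x < 1 ->
  (forall p : nat, \forall m \near \oo, ~ steep_cells p.+1%:R^-1 (q ^ m) x) ->
  is_derive x 1 F 0.
Proof.
move=> /andP[x0 x1] flat.
suff D : h^-1 *: ((F \o shift x) (h *: 1) - F x) @[h --> 0^'] --> (0 : R).
  by apply: DeriveDef; [apply/cvg_ex; exists 0 | apply: cvg_lim].
have qn0 m : (0 < q ^ m)%N by rewrite expn_gt0 (ltnW q_gt1).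
have q0 : 0 < q%:R :> R by rewrite ltr0n ltnW.
apply/cvgrPdist_le => e e0.
(* The slope bound obtained at the end is [3 * q / p.+1]. *)
pose p := Num.truncn (3 * q%:R / e).
have pe : 3 * q%:R * p.+1%:R^-1 <= e.
  rewrite ler_pdivrMr ?ltr0n// [leRHS]mulrC -ler_pdivrMr//; exact/ltW/truncnS_gt.
have [M _ flatM] := flat p.
pose r := Num.min x (1 - x).
have r0 : 0 < r by rewrite lt_min x0 subr_gt0.
(* From this level on [x] avoids the steep cells, and [2 / q ^ m] is at most the distance [r] to the
   endpoints. *)
pose M' := maxn M (Num.truncn (2 / r)).+1.
have d0 : 0 < (q ^ M')%:R^-1 :> R by rewrite invr_gt0 ltr0n.
apply/nbhs_ballP; exists (q ^ M')%:R^-1 => //= h; rewrite /ball/= sub0r normrN.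
move=> hM hN0; have h0 : 0 < `|h| by rewrite normr_gt0.
(* [m] is the largest exponent with [q ^ m <= 1 / |h|]. *)
pose N := Num.truncn (`|h|^-1); pose m := trunc_log q N.
have hi0 : 0 <= `|h|^-1 by rewrite invr_ge0.
have qN : (q ^ M' <= N)%N.
  by rewrite truncn_ge_nat// -[leLHS]invrK lef_pV2 ?posrE ?(ltW hM).
have Mm : (M' <= m)%N by rewrite /m trunc_log_max.
have N0 : (0 < N)%N by exact: leq_trans qN.
have /andP[qmN Nqm] := trunc_log_bounds q_gt1 N0.
have /andP[Nh hN] := truncn_itv hi0.
have n0 : 0 < (q ^ m)%:R :> R by rewrite ltr0n.
have h1 : `|h| <= (q ^ m)%:R^-1.
  rewrite -[leLHS]invrK lef_pV2 ?posrE ?invr_gt0//.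
  by apply: le_trans Nh; rewrite ler_nat.
have h2 : (q ^ m)%:R^-1 <= q%:R * `|h|.
  have : 1 <= (q ^ m.+1)%:R * `|h|.
    by rewrite -ler_pdivrMr// mul1r (le_trans (ltW hN))// ler_nat.
  by move=> ?; rewrite -[leLHS]mul1r ler_pdivrMr// mulrAC -natrM -expnS.
have xr : 2 / (q ^ m)%:R <= r.
  rewrite ler_pdivrMr// [leRHS]mulrC -ler_pdivrMr//.
  apply: (@le_trans _ _ (M'%:R)).
    apply: (@le_trans _ _ ((Num.truncn (2 / r)).+1)%:R); first exact/ltW/truncnS_gt.
    by rewrite ler_nat leq_maxr.
  rewrite ler_nat; apply: leq_trans (ltnW (ltn_expl _ q_gt1)).
  exact: Mm.
have key : `|F (h + x) - F x| <= 3 * p.+1%:R^-1 / (q ^ m)%:R.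
  apply: (@not_steep_cells _ (q ^ m)) => //.
  - move: xr; rewrite le_min => /andP[-> ?] /=; lra.
  - by apply: flatM => /=; apply: leq_trans Mm; rewrite leq_maxl.
  - by rewrite addrK.
rewrite sub0r normrN normrZ normfV /= -[h *: 1]/(h * 1) mulr1.
rewrite mulrC ler_pdivrMr//; apply: le_trans key _.
apply: (@le_trans _ _ (3 * p.+1%:R^-1 * (q%:R * `|h|))).
  by rewrite ler_wpM2l// mulr_ge0.
by rewrite mulrA ler_wpM2r// mulrAC.
Qed.

(** The steep cells of level [m] have measure at most a constant times [Num.sqrt k ^+ m], which is
    summable, so Borel-Cantelli applies to each threshold [1 / p.+1]. *)
Lemma singular_of_root_variation (k : R) : 0 <= k < 1 ->
  (forall m, root_variation F (q ^ m) ^+ 2 <= (q%:R * k) ^+ m) -> singular F.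
Proof.
move=> /andP[k0 k1] hF; have q0 := ltnW q_gt1.
pose B (p : nat) := lim_sup_set (fun m => steep_cells p.+1%:R^-1 (q ^ m)).
suff negB : (@lebesgue_measure R).-negligible (\bigcup_p B p).
  refine (negligibleS _ negB) => x /= xN; apply: contrapT => xB; apply: xN => x01.
  rewrite in_itv/= in x01; apply: is_derive_flat => // p.
  have : ~ B p x by move=> Bx; apply: xB; exists p.
  rewrite /B /lim_sup_set /bigcap/= => /existsNP[n /not_implyP[_ hn]].
  by exists n => // m /= nm steep; apply: hn; exists m.
apply: negligible_bigcup => p.
have mS m := measurable_steep_cells p.+1%:R^-1 (q ^ m).
apply/negligibleP.
  apply: bigcapT_measurable => n.
  by apply: bigcup_measurable => m _; exact: mS.
apply: lim_sup_set_cvg0 => //.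
have e0 : 0 < p.+1%:R^-1 :> R by rewrite invr_gt0.
pose c := 3 / Num.sqrt (p.+1%:R^-1 : R).
have c0 : 0 <= c by rewrite divr_ge0// sqrtr_ge0.
have sk1 : Num.sqrt k < 1 by rewrite -sqrtr1 ltr_sqrt.
have sk0 : 0 <= Num.sqrt k by exact: sqrtr_ge0.
have mle m : (lebesgue_measure (steep_cells p.+1%:R^-1 (q ^ m)) <=
    (c * Num.sqrt k ^+ m)%:E)%E.
  have n0 : (0 < q ^ m)%N by rewrite expn_gt0 q0.
  apply: le_trans (steep_cells_measure e0 n0) _; rewrite lee_fin.
  have rv : root_variation F (q ^ m) <= Num.sqrt (q ^ m)%:R * Num.sqrt k ^+ m.
    rewrite -(ger0_norm (root_variation_ge0 F _)) -sqrtr_sqr.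
    rewrite -sqrtrX_nneg// -sqrtrM ?ler0n// ler_wsqrtr//.
    by apply: le_trans (hF m) _; rewrite exprMn natrX.
  have s0 : 0 < Num.sqrt (q ^ m)%:R :> R by rewrite sqrtr_gt0 ltr0n.
  have s2 : Num.sqrt (q ^ m)%:R ^+ 2 = (q ^ m)%:R :> R by rewrite sqr_sqrtr.
  have e1 : 0 < Num.sqrt p.+1%:R^-1 :> R by rewrite sqrtr_gt0.
  (* The powers of [q ^ m] cancel: [1 / n] times one root of [n] from the threshold and one from
     [rv]. *)
  rewrite sqrtrM ?(ltW e0)// [Num.sqrt (q ^ m)%:R^-1]sqrtrV// /c.
  move: (Num.sqrt (q ^ m)%:R) (Num.sqrt p.+1%:R^-1) s0 s2 e1 rv => s t s0 <- t0 rv.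
  apply: le_trans (ler_wpM2l _ rv) _.
    by rewrite !mulr_ge0 ?invr_ge0 ?mulr_ge0 ?invr_ge0 ?exprn_ge0 ?(ltW s0) ?(ltW t0).
  rewrite le_eqVlt; apply/orP; left; apply/eqP; field.
  by rewrite !gt_eqF.
apply: (@le_lt_trans _ _ (c / (1 - Num.sqrt k))%:E); last exact: ltry.
apply: lime_le; first by apply: is_cvg_nneseries => *; exact: measure_ge0.
apply: nearW => n.
apply: (@le_trans _ _ (\sum_(0 <= i < n) (c * Num.sqrt k ^+ i)%:E)%E).
  by apply: lee_sum => m _; exact: mle.
rewrite sumEFin lee_fin.
have -> : \sum_(0 <= i < n) c * Num.sqrt k ^+ i =
    c * (1 - Num.sqrt k ^+ n) / (1 - Num.sqrt k).
  by have /(congr1 (@^~ n)) := geometric_seriesE c (negbT (lt_eqF sk1)).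
rewrite ler_wpM2r ?invr_ge0 ?subr_ge0 ?(ltW sk1)// -[leRHS]mulr1 ler_wpM2l//.
Qed.

End singular_criterion.

(** * Derivatives and smoothness of homographies *)

Lemma homography_den_gt0 (R : realType) (b x : R) :
  0 < b -> 0 <= x <= 1 -> 0 < b + (1 - b) * x.
Proof.
move=> b0 /andP[x0 x1].
have -> : b + (1 - b) * x = b * (1 - x) + x by ring.
have [->|xN0] := eqVneq x 0; first by rewrite subr0 mulr1 addr0.
by rewrite ltr_wpDl ?mulr_ge0 ?subr_ge0 ?(ltW b0)// lt_neqAle eq_sym xN0.
Qed.

Lemma is_derive_affine (R : realType) (b x : R) :
  is_derive x 1 (fun y => b + (1 - b) * y) (1 - b).
Proof.
apply: is_derive_eq.
by rewrite add0r mul1r -[_ *: _]/(_ * _) mulr1.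
Qed.

Lemma is_derive_homography (R : realType) (b x : R) : b + (1 - b) * x != 0 ->
  is_derive x 1 (fun y => y / (b + (1 - b) * y)) (b * (b + (1 - b) * x)^-1 ^+ 2).
Proof.
move=> D0.
have DV := is_deriveV (f := fun y => b + (1 - b) * y) D0 (is_derive_affine b x).
have DM := is_deriveM (is_derive_id x 1) DV.
apply: (@is_derive_eq _ _ _ _ _ _ _ _ DM).
by rewrite -![_ *: _]/(_ * _) /=; field.
Qed.

Lemma is_derive_inv_pow (R : realType) (b c x : R) n : b + (1 - b) * x != 0 ->
  is_derive x 1 (fun y => c * (b + (1 - b) * y)^-1 ^+ n.+1)
    (- (c * n.+1%:R * (1 - b)) * (b + (1 - b) * x)^-1 ^+ n.+2).
Proof.
move=> D0.
have DV := is_deriveV (f := fun y => b + (1 - b) * y) D0 (is_derive_affine b x).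
have := is_deriveX n.+1 DV; rewrite exprfctE => DX.
have DM := is_deriveM (is_derive_cst c x 1) DX.
apply: (@is_derive_eq _ _ _ _ _ _ _ _ DM).
rewrite -![_ *: _]/(_ * _) /= mulr0 addr0 -exprVn !exprS.
by ring.
Qed.

Lemma open_homography_domain (R : realType) (b : R) :
  open [set x : R | 0 < b + (1 - b) * x].
Proof.
rewrite (_ : [set x | _] = (fun x => b + (1 - b) * x) @^-1` [set z | 0 < z]) //.
apply: open_comp; last exact: open_gt.
by move=> x _; apply: cvgD; [exact: cvg_cst | apply: cvgM; [exact: cvg_cst | exact: cvg_id]].
Qed.

(** On the open set where the denominator is positive, the derivative of order [n.+1] is a constant
    times its inverse power [n.+2]. *)
Lemma smooth_homography (R : realType) (b : R) (F : R -> R) : 0 < b ->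
  (forall x, x \in `[0, 1] -> F x = x / (b + (1 - b) * x)) -> smooth_I F.
Proof.
move=> b0 FE; pose G x := x / (b + (1 - b) * x).
exists [set x | 0 < b + (1 - b) * x], G; split.
- exact: open_homography_domain.
- by move=> x; rewrite /= in_itv/=; exact: homography_den_gt0.
- by move=> x x01; rewrite FE.
have nth n : exists c, forall x, 0 < b + (1 - b) * x ->
    is_derive x 1 (derive1n n G) (c * (b + (1 - b) * x)^-1 ^+ n.+2).
  elim: n => [|n [c IHn]].
    by exists b => x x0; apply: is_derive_homography; rewrite gt_eqF.
  exists (- (c * n.+2%:R * (1 - b))) => x x0.
  have := @is_derive_inv_pow _ b c x n.+1.
  (* The formula for the previous derivative holds only on the domain, hence near [x] because the
     domain is open. *)
  rewrite gt_eqF// => /(_ isT); apply: near_eq_is_derive.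
  have : open_nbhs x [set y | 0 < b + (1 - b) * y].
    by split=> //; exact: open_homography_domain.
  move=> /open_nbhs_nbhs; apply: filterS => y /= y0.
  by rewrite -[RHS]/(derive1 (derive1n n G) y) derive1E; have [_ ->] := IHn _ y0.
by move=> n x /= x0; have [c /(_ _ x0)[]] := nth n.
Qed.

(** The inverse of [mob b] divides the odds by [b]. *)
Lemma mob_inv (R : realType) (b y x : R) : 0 < b -> y \in `[0, 1] ->
  x \in `[0, 1] -> mob b y = x -> y = x / (b + (1 - b) * x).
Proof.
rewrite !in_itv/= => b0 y01 /andP[x0 x1]; have D := mob_den_gt0 b0 y01.
rewrite /mob => /(canRL (divfK (lt0r_neq0 D))) e.
have D' : 0 < b + (1 - b) * x by apply: homography_den_gt0; rewrite ?x0.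
by apply/(canRL (mulfK (lt0r_neq0 D'))); lra.
Qed.

Lemma eq0_of_le_half_pow (R : realType) (x : R) :
  (forall n, `|x| <= (2 ^ n)%:R^-1) -> x = 0.
Proof.
move=> hx; apply/eqP; rewrite -normr_eq0 eq_le normr_ge0 andbT leNgt.
apply/negP => x0; have := hx (Num.truncn `|x|^-1).+1; apply/negP; rewrite -ltNge.
rewrite -[ltRHS]invrK ltf_pV2 ?posrE ?invr_gt0 ?ltr0n ?expn_gt0//.
by rewrite (lt_le_trans (truncnS_gt _))// ler_nat ltnW// ltn_expl.
Qed.

(** * The singular case and the fair case *)

Section solution.
Variables (R : realType) (A : 'I_2 -> 'I_2 -> 'M[R]_2) (phi : 'I_2 -> R -> R).
Hypothesis hLF : forall i, LF_system (A i 0) (A i 1).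
Hypothesis phi_I : forall i, maps_I (phi i).
Hypothesis phi_incr : forall i, {in `[0, 1] &, {homo phi i : x y / x <= y}}.
Hypothesis phi_eq : forall i j x, x \in `[0, 1] ->
  Phi (A i j) (phi j x) = phi i (dyadic_map i j x).

Lemma upd_beta i j : upd (A i j) (beta A i) = Phi (A i j)^T (alpha A i) + 1.
Proof. by rewrite /upd /beta addrK. Qed.

(** Iterated octupling gives the criterion with [q = 8] and [k = (7 + Num.sqrt (1 - d)) / 8], taken
    at [u = 1], where [mob] is the identity. *)
Lemma phi_singular i j k :
  Phi (A i j)^T (alpha A i) <> alpha A j -> singular (phi k).
Proof.
move=> neq; have neqU : upd (A i j) (beta A i) != beta A j.
  by apply/eqP; rewrite upd_beta => /addIr.
have [d /andP[d0 d1] gap] := bias_gap hLF neqU.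
have s1 : Num.sqrt (1 - d) < 1 by rewrite -[ltRHS]sqrtr1 ltr_sqrt//; lra.
have s0 : 0 <= Num.sqrt (1 - d) by exact: sqrtr_ge0.
have bnd m : rv_bounded phi (8 ^ m) ((7 + Num.sqrt (1 - d)) ^+ m).
  elim: m => [l u u0|m IHm]; last first.
    rewrite expnS exprS; apply: (rv_bounded_octuple hLF phi_I phi_eq) gap => //.
      by rewrite expn_gt0.
    exact: ltW.
  (* At level 0 there is one cell, and both values of [mob u] lie in [0, 1]. *)
  rewrite expn0 expr0 /root_variation big_ord1 mul0r divr1 /=.
  have I01 z : z \in `[0, 1] -> 0 <= mob u (phi l z) <= 1.
    by move=> /(phi_I l); rewrite in_itv => ?; exact: mob_itv.
  have /andP[a0 a1] : 0 <= mob u (phi l 1) <= 1 by rewrite I01// in_itv/= ler01 lexx.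
  have /andP[b0 b1] : 0 <= mob u (phi l 0) <= 1 by rewrite I01// in_itv/= ler01 lexx.
  rewrite expr_le1 ?sqrtr_ge0// -[leRHS]sqrtr1 ler_wsqrtr//; lra.
apply: (@singular_of_root_variation _ _ 8 _ _ ((7 + Num.sqrt (1 - d)) / 8)) => //.
  by lra.
move=> m; have -> : 8%:R * ((7 + Num.sqrt (1 - d)) / 8) = 7 + Num.sqrt (1 - d) by field.
have := bnd m k 1 ltr01.
by rewrite (_ : mob 1 \o phi k = phi k)//; apply/funext => x /=; rewrite mob1.
Qed.

Hypothesis fair : forall i j, Phi (A i j)^T (alpha A i) = alpha A j.

(** Under fairness [upd] carries each [beta] to the next, so the curve obeys the same halving
    relations as the identity; each level halves the distance between them. *)
Lemma mob_phi_id i x : x \in `[0, 1] -> mob (beta A i) (phi i x) = x.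
Proof.
move=> x01; apply/eqP; rewrite -subr_eq0; apply/eqP/eq0_of_le_half_pow => n.
have b0 k := beta_gt0 (hLF k).
have half k : prob (beta A k) (beta A k) = 1 / 2.
  by have := b0 k; rewrite /prob => ?; field; lra.
have step k l : upd (A k l) (beta A k) = beta A l by rewrite upd_beta fair.
elim: n i x x01 => [|n IHn] i x x01.
  have := phi_I i x01; rewrite in_itv => /(mob_itv (b0 i)) /andP[m0 m1].
  move: x01; rewrite in_itv/= => /andP[x0 x1].
  by rewrite expn0 invr1 ler_norml; lra.
have cut (y z : R) : y = z / 2 -> `|z| <= (2 ^ n)%:R^-1 -> `|y| <= (2 ^ n.+1)%:R^-1.
  move=> -> hz; rewrite expnS natrM invfM mulrC normrM.
  by rewrite [X in X * _]gtr0_norm ?invr_gt0// ler_wpM2l.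
move: x01; rewrite in_itv/= => /andP[x0 x1].
have [xh|hx] := leP x 2^-1.
  have y01 : 2 * x \in `[0, 1] by rewrite in_itv/=; lra.
  apply: cut (IHn 0 _ y01).
  have {1}-> : x = 2 * x / 2 by field.
  by rewrite (mob_phi0 hLF phi_I phi_eq)// half step; field.
have y01 : 2 * x - 1 \in `[0, 1] by rewrite in_itv/=; lra.
apply: cut (IHn 1 _ y01).
have {1}-> : x = (2 * x - 1 + 1) / 2 by field.
by rewrite (mob_phi1 hLF phi_I phi_eq)// half step; field.
Qed.

Lemma phi_homography i x : x \in `[0, 1] ->
  phi i x = x / (beta A i + (1 - beta A i) * x).
Proof.
by move=> x01; apply: mob_inv (mob_phi_id i x01) => //; [exact: beta_gt0 | exact: phi_I].
Qed.

Lemma phi_smooth i : smooth_I (phi i).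
Proof. exact: smooth_homography (beta_gt0 (hLF i)) (phi_homography i). Qed.

(** Fairness for [i = j = 0] makes [beta A 0] a fixed point, which forces [d = 2 * a]. *)
Lemma beta_fair0 : beta A 0 = 1 + A 0 0 1 0 / A 0 0 0 0.
Proof.
have [_ a0 d0 h] := LF_entries0 (hLF 0).
have : upd (A 0 0) (beta A 0) = beta A 0 by rewrite upd_beta fair.
rewrite (upd0E (hLF 0)) (beta0E (hLF 0)).
move: (A 0 0 0 0) (A 0 0 1 0) (A 0 0 1 1) a0 d0 h => a c d a0 d0 h.
rewrite mulrCA divff ?gt_eqF// mulr1 => e.
have {}e : (c + d - a) * (2 * a) = (c + d - a) * d.
  move/eqP: e; rewrite eqr_div ?(gt_eqF a0) ?(gt_eqF d0)// => /eqP <-; ring.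
have -> : d = 2 * a by apply/esym; apply: mulfI e; rewrite gt_eqF// subr_gt0.
by field; rewrite gt_eqF.
Qed.

(** Dividing the fixed-point equation for [i = j = 1] by [beta A 1 > 0] gives [c = d - 2 * b]. *)
Lemma beta_fair1 : beta A 1 = 1 + A 1 1 1 0 / A 1 1 0 1.
Proof.
have [b0 bd cd _] := LF_entries1 (hLF 1); have beta0 := beta_gt0 (hLF 1).
have D := upd1_den_gt0 (hLF 1) beta0.
have : upd (A 1 1) (beta A 1) = beta A 1 by rewrite upd_beta fair.
rewrite (upd1E (hLF 1) beta0) -mulrA mulrCA -[RHS]mulr1 => /(mulfI (lt0r_neq0 beta0)).
move=> /divr1_eq; rewrite (beta1E (hLF 1)) mulrCA divff ?gt_eqF// mulr1 => e.
have -> : A 1 1 1 0 = A 1 1 1 1 - 2 * A 1 1 0 1 by lra.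
by field; rewrite gt_eqF.
Qed.

End solution.

Theorem theorem4p1 (R : realType) (A : 'I_2 -> 'I_2 -> 'M[R]_2)
    (phi : 'I_2 -> R -> R)
    (hLF : forall i, LF_system (A i 0) (A i 1))
    (phi_I : forall i, maps_I (phi i))
    (phi_incr : forall i, {in `[0, 1] &, {homo phi i : x y / x <= y}})
    (phi_cont : forall i, {within `[0, 1], continuous (phi i)})
    (phi_eq : forall i j x, x \in `[0, 1] ->
       Phi (A i j) (phi j x) = phi i (dyadic_map i j x)) :
  ((exists i j, Phi (A i j)^T (alpha A i) <> alpha A j) ->
     singular (phi 0) /\ singular (phi 1))
  /\
  ((forall i j, Phi (A i j)^T (alpha A i) = alpha A j) ->
     let c00 := (A 0 0) 1 0 / (A 0 0) 0 0 in
     let c11 := (A 1 1) 1 0 / (A 1 1) 0 1 in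
     [/\ forall x, x \in `[0, 1] -> phi 0 x = x / (- c00 * x + 1 + c00),
         forall x, x \in `[0, 1] -> phi 1 x = x / (- c11 * x + 1 + c11),
         smooth_I (phi 0)
       & smooth_I (phi 1)]).
Proof.
split=> [[i [j neq]]|fair c00 c11].
  by split; apply: (phi_singular hLF phi_I phi_incr phi_eq _ neq).
have den (c x : R) : - c * x + 1 + c = 1 + c + (1 - (1 + c)) * x by ring.
split.
- by move=> x x01; rewrite den -(beta_fair0 hLF fair) -(phi_homography hLF phi_I phi_eq fair).
- by move=> x x01; rewrite den -(beta_fair1 hLF fair) -(phi_homography hLF phi_I phi_eq fair).
- exact: (phi_smooth hLF phi_I phi_eq fair).
- exact: (phi_smooth hLF phi_I phi_eq fair).
Qed.
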